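(* Let $(X,d)$ be a complete metric space, let $F:X\to(-\infty,+\infty]$ be a lower semicontinuous functional, bounded from below, whose proper domain $D(F)=\{w\in X:F(w)<+\infty\}$ is dense in $X$, let $\lambda\in\mathbb{R}$, and let $X_0\subset D(F)$ be a subset such that $$\text{for every }u\in X\text{ there exist }u_n\in X_0\text{ with }\lim_{n\to\infty}d(u_n,u)=0,\quad\lim_{n\to\infty}F(u_n)=F(u).$$ Let $\mathsf{S}$ be a $\lambda$-flow for $F$ in $X_0$. Then $\mathsf{S}$ can be extended to a unique $\lambda$-flow $\bar{\mathsf{S}}$ for $F$ in $X$, and therefore $F$ is (strongly) geodesically $\lambda$-convex in $X$.
   Context: For a metric space $(Y,d)$ and a lower semicontinuous functional $F:Y\to(-\infty,+\infty]$, bounded from below, with dense proper domain $D(F)$: a $C^0$-semigroup on $Y$ is a family $\mathsf{S}_t:Y\to Y$, $t\ge0$, of continuous maps with $\mathsf{S}_{t+h}(u)=\mathsf{S}_h(\mathsf{S}_t(u))$ and $\lim_{t\downarrow0}\mathsf{S}_t(u)=\mathsf{S}_0(u)=u$ for all $u\in Y$, $t,h\ge0$. It is a $\lambda$-flow for $F$ in $Y$ if: (a) $\mathsf{S}_t(Y)\subset D(F)$ for every $t>0$; (b) for every $u\in Y$ the map $t\mapsto F(\mathsf{S}_t(u))$ is non-increasing on $(0,+\infty)$; (c) $\frac12\frac{d^+}{dt}d^2(\mathsf{S}_t(u),v)+\frac\lambda2d^2(\mathsf{S}_t(u),v)+F(\mathsf{S}_t(u))\le F(v)$ for all $u\in Y$,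 $v\in D(F)$, $t\ge0$, where $\frac{d^+}{dt}\zeta(t)=\limsup_{h\downarrow0}\frac{\zeta(t+h)-\zeta(t)}h$. When $t=0$ and $F(u)=+\infty$, (c) is understood with $F(\mathsf{S}_t(u))$ moved to the right-hand side, i.e. $\frac{d^+}{dt}d^2(\mathsf{S}_t(u),v)|_{t=0}=-\infty$. A $\lambda$-flow for $F$ in $X_0$ means a $\lambda$-flow for the restriction of $F$ to the metric space $Y=X_0$ (with the distance of $X$). $F$ is (strongly) geodesically $\lambda$-convex in $X$ if for every curve $\gamma:[0,1]\to X$ with $d(\gamma^r,\gamma^s)=|r-s|\,d(\gamma^0,\gamma^1)$ for all $r,s\in[0,1]$ (geodesic) one has $F(\gamma^s)\le(1-s)F(\gamma^0)+sF(\gamma^1)-\frac\lambda2s(1-s)d^2(\gamma^0,\gamma^1)$ for all $s\in[0,1]$ (with $0\cdot(+\infty)=0$). *)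

(* Defs.v *)
From HB Require Import structures.
From mathcomp Require Import all_boot all_order all_algebra.
From mathcomp Require Import all_classical all_reals all_analysis.

Set Implicit Arguments.
Unset Strict Implicit.
Unset Printing Implicit Defensive.

Import Order.TTheory GRing.Theory Num.Theory.
Import numFieldNormedType.Exports.

Local Open Scope classical_set_scope.
Local Open Scope ring_scope.

(* The library equips a subset, seen as a type, with a pseudometric structure
   only; this completes it to the metric restricted from the ambient space. *)
Section subset_metric.
Context {R : realType} {X : metricType R} (A : set X).

Let sub_dist (x y : A) : R := mdist (val x) (val y).

Let sub_dist_ge0 x y : 0 <= sub_dist x y.
Proof. exact: mdist_ge0. Qed.

Let sub_dist_positivity x y : sub_dist x y = 0 -> x = y.
Proof. by move=> /mdist_positivity /val_inj. Qed.

Let ball_sub_dist x e : ball x e = [set y | sub_dist x y < e].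
Proof. by rewrite -initial_ballE ballEmdist. Qed.

HB.instance Definition _ := @PseudoMetric_isMetric.Build R (A : Type)
  sub_dist sub_dist_ge0 sub_dist_positivity ball_sub_dist.

End subset_metric.

(* The library's class of complete spaces requires a distinguished point, which
   a metric space need not have. *)
Definition complete_metric {R : realType} (X : metricType R) : Prop :=
  forall u : nat -> X, cauchy (u @ \oo) -> exists l : X, u @ \oo --> l.

Definition domain {R : realType} {Y : Type} (F : Y -> \bar R) : set Y :=
  [set w | (F w < +oo)%E].

Definition bounded_from_below {R : realType} {Y : Type} (F : Y -> \bar R) : Prop :=
  exists m : R, forall w, (m%:E <= F w)%E.

Definition upper_right_derivative {R : realType} (zeta : R -> R) (t : R) : \bar R :=
  limf_esup (fun h : R => ((zeta (t + h) - zeta t) / h)%:E) 0^'+.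

(* Time ranges over all of R for convenience: only the values [S t] with
   [0 <= t] are meaningful, and nothing is required of the others. *)
Record C0_semigroup {R : realType} {Y : metricType R} (S : R -> Y -> Y) : Prop := {
  C0_continuous : forall t : R, 0 <= t -> continuous (S t) ;
  C0_add : forall (t h : R) u, 0 <= t -> 0 <= h -> S (t + h) u = S h (S t u) ;
  C0_zero : forall u, S 0 u = u ;
  C0_right_limit : forall u, S t u @[t --> 0^'+] --> u }.

(* The evolution variational inequality is split according to the finiteness of
   [F (S t u)]: [flow_domain] makes it finite for t > 0, and [flow_evi0] is the
   meaning of the inequality at t = 0 when F u = +oo. *)
Record lambda_flow {R : realType} {Y : metricType R} (F : Y -> \bar R)
    (lambda : R) (S : R -> Y -> Y) : Prop := {
  flow_semigroup : C0_semigroup S ;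
  flow_domain : forall (t : R) u, 0 < t -> domain F (S t u) ;
  flow_nonincreasing : forall u (s t : R), 0 < s -> s <= t ->
    (F (S t u) <= F (S s u))%E ;
  flow_evi : forall u v (t : R), domain F v -> 0 <= t -> domain F (S t u) ->
    (2^-1%:E * upper_right_derivative (fun r : R => mdist (S r u) v ^+ 2)%R t
       + (lambda / 2 * mdist (S t u) v ^+ 2)%:E + F (S t u) <= F v)%E ;
  flow_evi0 : forall u v, domain F v -> F u = +oo%E ->
    upper_right_derivative (fun r : R => mdist (S r u) v ^+ 2) 0 = -oo%E }.

(* Constant-speed geodesics, parametrised by R and constrained on [0, 1] only. *)
Definition geodesic {R : realType} {X : metricType R} (g : R -> X) : Prop :=
  forall r s : R, 0 <= r <= 1 -> 0 <= s <= 1 ->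
    mdist (g r) (g s) = `|r - s| * mdist (g 0) (g 1).

(* The convention 0 * +oo = 0 is that of the library. *)
Definition geodesically_convex {R : realType} {X : metricType R}
    (F : X -> \bar R) (lambda : R) : Prop :=
  forall g : R -> X, geodesic g -> forall s : R, 0 <= s <= 1 ->
    (F (g s) <= (1 - s)%:E * F (g 0%R) + s%:E * F (g 1%R)
                - (lambda / 2 * s * (1 - s) * mdist (g 0%R) (g 1%R) ^+ 2)%:E)%E.

Definition extends_flow {R : realType} {X : metricType R} {X0 : set X}
    (S : R -> X0 -> X0) (Sbar : R -> X -> X) : Prop :=
  forall (t : R) (u : X0), 0 <= t -> Sbar t (val u) = val (S t u).

(* Main.v *)
Require Import Defs.
From mathcomp Require Import all_boot all_order all_algebra.
From mathcomp Require Import all_classical all_reals all_analysis.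
From mathcomp Require Import ring lra.

(** The proof replaces the evolution variational inequality with its integrated
    form ([integral_flow]): for all [t > 0] and all [v] in the domain of [F],
    [expR (lambda * t) * d^2 (S t u, v) - d^2 (u, v) <=
    2 * exp_integral lambda t * (F v - F (S t u))],
    where [exp_integral lambda t] is the integral of [expR (lambda * r)] for [r]
    from 0 to [t].

    A [lambda]-flow satisfies it ([integral_flow_of_lambda_flow]), because [F]
    decreases along the flow and a continuous function with nonpositive upper
    right derivative decreases. The continuity of orbits required there follows
    from right continuity and a category argument ([orbit_continuous]).

    The integrated inequality has three consequences. If [F] is bounded below,
    [S t] is Lipschitz on the domain of [F] with constant
    [expR (- (lambda * t))] ([integral_flow_contraction]). If [F] is lower
    semicontinuous, the differential inequality can be recovered
    ([lambda_flow_of_integral_flow]) and [F] is convex along geodesics: the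
    inequality started at an intermediate point is tested against the two
    endpoints ([geodesically_convex_of_integral_flow]).

    By contraction and completeness, [S t] extends from [X0] to [X]. The
    integrated inequality survives the extension, since it passes to the limit
    along recovery sequences ([integral_flow_extension]); so the extension is a
    [lambda]-flow on [X] and [F] is convex. Two extensions agree because
    their time-[t] maps are continuous and coincide on a dense set. *)

Set Implicit Arguments.
Unset Strict Implicit.
Unset Printing Implicit Defensive.

Import Order.TTheory GRing.Theory Num.Theory.
Import numFieldNormedType.Exports.

Local Open Scope classical_set_scope.
Local Open Scope ring_scope.

(** * Monotonicity from bounds on increments *)

Lemma near_upper_right_derivative (R : realType) (f : R -> R) (t L e : R) :
  (upper_right_derivative f t <= L%:E)%E -> 0 < e ->
  \forall h \near 0^'+, f (t + h) <= f t + (L + e) * h.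
Proof.
move=> fL e0.
have : (upper_right_derivative f t < (L + e)%:E)%E.
  by rewrite (le_lt_trans fL)// lte_fin ltrDl.
rewrite /upper_right_derivative limf_esupE => /ereal_inf_lt[_ [V nV <-] VL].
near=> h.
have h0 : 0 < h by near: h; exact: nbhs_right_gt.
have Vh : V h by near: h.
rewrite -lerBlDl -ler_pdivrMr// -lee_fin ltW// (le_lt_trans _ VL)//.
by apply: ereal_sup_ubound; exists h.
Unshelve. all: by end_near. Qed.

Lemma upper_right_derivative_le (R : realType) (f : R -> R) (t c : R) :
  (\forall h \near 0^'+, f (t + h) - f t <= c * h) ->
  (upper_right_derivative f t <= c%:E)%E.
Proof.
move=> fc; rewrite /upper_right_derivative limf_esupE.
set V := [set h : R | ((f (t + h) - f t) / h <= c)%R].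
apply: (@le_trans _ _ (ereal_sup [set ((f (t + h) - f t) / h)%:E | h in V])).
  apply: ereal_inf_lbound; exists V => //.
  near=> h; rewrite /V/= ler_pdivrMr; first by near: h.
  by near: h; exact: nbhs_right_gt.
by apply: ge_ereal_sup => _ [h Vh <-]; rewrite lee_fin.
Unshelve. all: by end_near. Qed.

(** The supremum of the times at which [f t <= f a + e * (t - a)] is one of them
    by left continuity, and it cannot precede [b], since the bound on right
    increments would carry the inequality a little further. *)
Lemma le_of_right_increments (R : realType) (f : R -> R) (a b : R) :
  a <= b ->
  (forall t e, a <= t < b -> 0 < e ->
     \forall h \near 0^'+, f (t + h) <= f t + e * h) ->
  (forall t, a < t <= b -> {for t, continuous f}) ->
  f b <= f a.
Proof.
move=> ab inc cf; apply/ler_addgt0Pr => e0 e0_gt0.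
(* The [+ 1] only avoids dividing by 0 when [a = b]. *)
have [e e_gt0 ee0] : exists2 e, 0 < e & e * (b - a) <= e0.
  exists (e0 / (b - a + 1)); first by rewrite divr_gt0//; lra.
  rewrite mulrAC ler_pdivrMr; last by lra.
  by rewrite ler_wpM2l//; [exact: ltW|lra].
apply: le_trans (_ : f a + e * (b - a) <= _); last by rewrite lerD2l.
set A := [set t : R | a <= t <= b /\ f t <= f a + e * (t - a)].
have Aa : A a by split; [rewrite lexx|rewrite subrr mulr0 addr0].
have hA : has_sup A by split; [exists a|exists b => x [/andP[]]].
set tau := sup A.
have atau : a <= tau by exact: (sup_upper_bound hA).
have taub : tau <= b by apply: ge_sup; [exists a|move=> x [/andP[]]].
have Atau : f tau <= f a + e * (tau - a).
  rewrite leNgt; apply/negP => ftau.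
  have {}atau : a < tau.
    rewrite lt_neqAle atau andbT; apply/eqP => /esym taua.
    by move: ftau; rewrite taua subrr mulr0 addr0 ltxx.
  have gc : {for tau, continuous (fun t => f t - e * t)}.
    apply: cvgB; first by apply: cf; rewrite atau.
    by apply: cvgM; [exact: cvg_cst|exact: cvg_id].
  have : \forall t \near tau, f a - e * a < f t - e * t.
    by apply: (cvgr_gt _ gc); rewrite mulrBr in ftau; lra.
  move=> /nbhs_ballP[d /= d0 dP].
  have [x Ax xd] := sup_adherent d0 hA.
  have xtau : x <= tau by exact: (sup_upper_bound hA).
  have /dP/= : ball tau d x.
    by rewrite /ball/= ger0_norm ?subr_ge0// ltrBlDl -ltrBlDr.
  by case: Ax => _; rewrite mulrBr; lra.
have [->//|taunb] := eqVneq b tau.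
have {taunb}taub' : tau < b by rewrite lt_neqAle taub andbT eq_sym.
have : \forall h \near 0^'+, f (tau + h) <= f tau + e * h.
  by apply: inc => //; rewrite atau.
move=> incr; near (0 : R)^'+ => h.
have h0 : 0 < h by near: h; exact: nbhs_right_gt.
have hb : h < b - tau by near: h; apply: nbhs_right_lt; rewrite subr_gt0.
have h1 : f (tau + h) <= f tau + e * h by near: h.
have /(sup_upper_bound hA) : A (tau + h).
  split; first by apply/andP; split; lra.
  by rewrite (le_trans h1)//; lra.
by rewrite -/tau; lra.
Unshelve. all: by end_near. Qed.

(** Cutting [[0, T]] into [n] equal steps, the increments of [H] telescope and
    leave [phi T - phi 0 <= (T / n) * (H 0 - H T)], which vanishes as [n]
    grows. The increments of [H] may thus be of order one, as long as they are
    weighted by the step: no derivative of [phi] is involved. *)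
Lemma le_of_small_increments (R : realType) (phi H : R -> R) (T : R) :
  0 <= T ->
  (forall t h, 0 <= t -> 0 <= h -> t + h <= T ->
     phi (t + h) <= phi t + h * (H t - H (t + h))) ->
  phi T <= phi 0.
Proof.
move=> T0 inc; apply/ler_addgt0Pr => e e0.
pose M := T * `|H 0 - H T|.
have M0 : 0 <= M by rewrite mulr_ge0.
have [n Mn] : exists n, M / e < n.+1%:R.
  exists (Num.truncn (M / e)); exact: truncnS_gt.
set h := T / n.+1%:R.
have h0 : 0 <= h by rewrite divr_ge0.
have hT : n.+1%:R * h = T by rewrite mulrCA divff// mulr1.
have tele k : (k <= n.+1)%N ->
    phi (k%:R * h) <= phi 0 + h * (H 0 - H (k%:R * h)).
  elim: k => [_|k IH kn]; first by rewrite mul0r subrr mulr0 addr0.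
  have kT : k%:R * h + h <= T.
    by rewrite -{2}[h]mul1r -mulrDl natr1 -hT ler_wpM2r// ler_nat.
  rewrite -natr1 mulrDl mul1r.
  have := inc _ _ (mulr_ge0 (ler0n _ k) h0) h0 kT.
  by have := IH (ltnW kn); lra.
have := tele n.+1 (leqnn _); rewrite hT => /le_trans; apply.
rewrite lerD2l; apply: (@le_trans _ _ (h * `|H 0 - H T|)).
  by rewrite ler_wpM2l// ler_norm.
rewrite /h mulrAC ler_pdivrMr// [leRHS]mulrC -ler_pdivrMr//; exact: ltW.
Qed.

(** * The integral of an exponential *)

(** The integral of [expR (lambda * r)] for [r] from 0 to [t], in closed form.
    The identity [lambda * exp_integral lambda t = expR (lambda * t) - 1] holds
    for every [lambda] and confines the case distinction to the first lemmas. *)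
Definition exp_integral (R : realType) (lambda t : R) : R :=
  if lambda == 0 then t else (expR (lambda * t) - 1) / lambda.

Lemma mul_exp_integral (R : realType) (lambda t : R) :
  lambda * exp_integral lambda t = expR (lambda * t) - 1.
Proof.
rewrite /exp_integral; case: eqVneq => [->|l0]; first by rewrite !mul0r expR0 subrr.
by rewrite mulrCA divff// mulr1.
Qed.

Lemma exp_integralD (R : realType) (lambda t h : R) :
  exp_integral lambda (t + h) =
  exp_integral lambda t + expR (lambda * t) * exp_integral lambda h.
Proof.
rewrite /exp_integral; case: eqVneq => [->|l0].
  by rewrite mul0r expR0 mul1r.
by rewrite mulrDr expRD; field.
Qed.

(** Both bounds come from [1 + x <= expR x] at [x = lambda * t] and at
    [x = - (lambda * t)]; which of the two gives the upper one depends on the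
    sign of [lambda]. *)
Lemma exp_integral_bounds (R : realType) (lambda t : R) : 0 <= t ->
  t * expR (- (`|lambda| * t)) <= exp_integral lambda t <=
  t * expR (`|lambda| * t).
Proof.
move=> t0.
have m1 := expR_ge1Dx (lambda * t).
have m2 : expR (lambda * t) - 1 <= lambda * t * expR (lambda * t).
  have := expR_ge1Dx (- (lambda * t)).
  move=> /(ler_wpM2l (expR_ge0 (lambda * t))).
  by rewrite expRxMexpNx_1 mulrDr; lra.
rewrite /exp_integral; have [l0|l0|_] := ltrgt0P lambda.
- rewrite ler_pdivrMr// ler_pdivlMr//; apply/andP; split; last first.
    by rewrite (le_trans m2)// [leRHS]mulrC mulrA.
  apply: (@le_trans _ _ (t * lambda)); last by lra.
  rewrite -[leRHS]mulr1 mulrAC ler_wpM2l//; first by rewrite mulr_ge0// ltW.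
  by rewrite expR_le1 oppr_le0 mulr_ge0// ltW.
- rewrite mulNr opprK ler_ndivrMr// ler_ndivlMr//; apply/andP; split.
    by rewrite (le_trans m2)// [leRHS]mulrC mulrA.
  apply: (@le_trans _ _ (t * lambda)); last by lra.
  rewrite -[leRHS]mulr1 mulrAC ler_wnM2l//; first by rewrite mulr_ge0_le0// ltW.
  by rewrite -expR0 ler_expR oppr_ge0 mulr_le0_ge0// ltW.
- by rewrite mul0r oppr0 expR0 mulr1 lexx.
Qed.

Lemma exp_integral_gt0 (R : realType) (lambda t : R) : 0 < t ->
  0 < exp_integral lambda t.
Proof.
move=> t0; have /andP[+ _] := exp_integral_bounds lambda (ltW t0).
by apply: lt_le_trans; rewrite mulr_gt0// expR_gt0.
Qed.

Lemma cvg_expRM0 (R : realType) (lambda : R) :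
  expR (lambda * h) @[h --> (0 : R)^'+] --> (1 : R).
Proof.
apply: cvg_at_right_filter; rewrite -[X in _ --> X]expR0 -[X in expR X](mulr0 lambda).
apply: continuous_cvg; first exact: continuous_expR.
by apply: cvgM; [exact: cvg_cst|exact: cvg_id].
Qed.

Lemma cvg_exp_integral (R : realType) (lambda : R) :
  exp_integral lambda h / h @[h --> (0 : R)^'+] --> (1 : R).
Proof.
apply: (squeeze_cvgr _ (cvg_expRM0 (- `|lambda|)) (cvg_expRM0 `|lambda|)).
near=> h; have h0 : 0 < h by near: h; exact: nbhs_right_gt.
rewrite ler_pdivlMr// ler_pdivrMr// mulNr ![expR _ * _]mulrC.
exact: exp_integral_bounds (ltW h0).
Unshelve. all: by end_near. Qed.

Lemma continuous_exp_integral (R : realType) (lambda : R) :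
  continuous (exp_integral lambda).
Proof.
rewrite /exp_integral => t; case: eqVneq => _; first exact: cvg_id.
apply: cvgM; last exact: cvg_cst.
apply: cvgB; last exact: cvg_cst.
apply: continuous_cvg; first exact: continuous_expR.
by apply: cvgM; [exact: cvg_cst|exact: cvg_id].
Qed.

(** * Continuity of orbits in positive time *)

(** Baire category: the points near which [f] oscillates by less than [1 / n]
    form an open set, which is dense because immediately to the right of any
    point [f] is almost constant. *)
Lemma dense_continuity_points (R : realType) (Y : metricType R) (f : R -> Y) :
  (forall t, f x @[x --> t^'+] --> f t) ->
  dense [set t : R | {for t, continuous f}].
Proof.
move=> rcf.
pose U (n : nat) : set R^o := [set t | exists2 d, 0 < d &
  forall x y, ball t d x -> ball t d y -> mdist (f x) (f y) < n.+1%:R^-1].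
have /Baire : forall n, open (U n) /\ dense (U n).
  move=> n; split.
    rewrite openE => t [d d0 dP]; apply/nbhs_ballP.
    exists (d / 2) => [|s ts]; first by rewrite /= divr_gt0.
    exists (d / 2); first by rewrite divr_gt0.
    by move=> x y sx sy; apply: dP; apply: ball_split; eassumption.
  move=> O [t Ot] oO.
  have /(metricType_numDomainType.cvgr_dist_lt)/(_ (n.+1%:R^-1 / 2)) := rcf t.
  rewrite divr_gt0// => /(_ isT) ft.
  have : nbhs t O by apply: open_nbhs_nbhs.
  move=> /nbhs_ballP[d1 /= d10 d1O].
  move: ft => /nbhs_ballP[d2 /= d20 d2f].
  pose d := Num.min d1 d2.
  have d0 : 0 < d by rewrite lt_min d10.
  have dd1 : d <= d1 by rewrite ge_min lexx.
  have dd2 : d <= d2 by rewrite ge_min lexx orbT.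
  exists (t + d / 2); split.
    apply: d1O; rewrite /ball/= opprD addrA subrr sub0r normrN gtr0_norm; lra.
  exists (d / 2); first by rewrite divr_gt0.
  suff ftd x : ball (t + d / 2) (d / 2) x -> mdist (f t) (f x) < n.+1%:R^-1 / 2.
    move=> x y /ftd fx /ftd fy.
    rewrite (le_lt_trans (metric_triangle _ (f t) _))//.
    by rewrite (metric_sym (f x)) [ltRHS]splitr ltrD.
  rewrite /ball/= ltr_norml => /andP[x1 x2].
  apply: d2f; last by lra.
  by rewrite /ball/= /ball_/= ltr_norml; apply/andP; split; lra.
move=> dU O O0 oO; have [t [Ot Ut]] := dU O O0 oO.
exists t; split => //; apply/metricType_numDomainType.cvgrPdist_lt => e e0.
have [d d0 dP] := Ut (Num.truncn e^-1) I.
apply/nbhs_ballP; exists d => // y ty.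
have := dP t y (ballxx _ d0) ty => /lt_le_trans; apply.
by rewrite invf_ple ?posrE// ltW// truncnS_gt.
Qed.

Lemma cvg_mdist (R : realType) (Y : metricType R) (T : Type)
    (G : set_system T) (FG : Filter G) (f g : T -> Y) (y z : Y) :
  f x @[x --> G] --> y -> g x @[x --> G] --> z ->
  mdist (f x) (g x) @[x --> G] --> mdist y z.
Proof.
move=> fy gz; apply/cvgrPdist_lt => e e0.
have e20 : 0 < e / 2 by rewrite divr_gt0.
near=> x.
have fx : mdist y (f x) < e / 2.
  by near: x; exact: metricType_numDomainType.cvgr_dist_lt.
have gx : mdist z (g x) < e / 2.
  by near: x; exact: metricType_numDomainType.cvgr_dist_lt.
have := metric_triangle (f x) y (g x); have := metric_triangle y z (g x).
have := metric_triangle y (f x) z; have := metric_triangle (f x) (g x) z.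
rewrite (metric_sym (f x) y) (metric_sym (g x) z) => h1 h2 h3 h4.
by rewrite ltr_norml; apply/andP; split; lra.
Unshelve. all: by end_near. Qed.

Lemma orbit_right_continuous (R : realType) (Y : metricType R)
    (S : R -> Y -> Y) (u : Y) (t : R) :
  C0_semigroup S -> 0 <= t -> S r u @[r --> t^'+] --> S t u.
Proof.
move=> SS t0; apply/metricType_numDomainType.cvgrPdist_lt => e e0.
have /metricType_numDomainType.cvgr_dist_lt := @C0_right_limit _ _ _ SS (S t u).
move=> /(_ e e0)/nbhs_ballP[d /= d0 dP]; apply/nbhs_ballP; exists d => //= r tr rt.
rewrite -(subrK t r) addrC (C0_add SS)// ?subr_ge0 ?ltW//.
apply: dP; last by rewrite /= subr_gt0.
by move: tr; rewrite /ball/= sub0r opprB.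
Qed.

(** A semigroup is only assumed to be right continuous in time, while left
    continuity is needed to integrate a bound on a right derivative. The orbit
    is continuous at some [s] in [(0, t)] by category, and the continuous map
    [S (t - s)] transports this continuity from [s] to [t]. *)
Lemma orbit_continuous (R : realType) (Y : metricType R)
    (S : R -> Y -> Y) (u : Y) (t : R) :
  C0_semigroup S -> 0 < t -> {for t, continuous (fun r => S r u)}.
Proof.
move=> SS t0.
(* Freezing the orbit at negative times makes it right continuous on the whole
   line. *)
pose f r := S (Num.max r 0) u.
have rcf r : f x @[x --> r^'+] --> f r.
  have [r0|r0] := leP 0 r.
    rewrite {2}/f (max_l r0).
    apply: cvg_trans (orbit_right_continuous SS r0).
    apply: near_eq_cvg; near=> x; rewrite /f max_l// ltW//.
    by rewrite (le_lt_trans r0)//; near: x; exact: nbhs_right_gt.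
  rewrite {2}/f (max_r (ltW r0)).
  have fcst : \forall x \near r^'+, S 0 u = f x.
    by near=> x; rewrite /f max_r// ltW//; near: x; exact: nbhs_right_lt.
  by apply: cvg_trans (near_eq_cvg fcst) _; exact: cvg_cst.
have oI : open (ball (t / 2 : R) (t / 2)) by exact: ball_open.
have [] := dense_continuity_points rcf _ oI.
  by exists (t / 2); apply: ballxx; rewrite divr_gt0.
move=> s []; rewrite /ball/= ltr_norml => /andP[s1 s2] cs.
have s0 : 0 < s by lra.
have st : s < t by lra.
have ct : f (r - (t - s)) @[r --> t] --> S s u.
  have <- : f s = S s u by rewrite /f max_l// ltW.
  have h : r - (t - s) @[r --> t] --> s.
    rewrite -[X in _ --> X](subKr t).
    by apply: cvgB; [exact: cvg_id|exact: cvg_cst].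
  exact: (cvg_comp _ _ h cs).
have := C0_continuous SS (ltW (_ : 0 < t - s)).
rewrite subr_gt0 => /(_ st (S s u)) /(cvg_comp _ _ ct).
rewrite /continuous_at -(C0_add SS) ?subr_ge0 ?(ltW s0) ?(ltW st)//.
have -> : s + (t - s) = t by lra.
apply: cvg_trans; apply: near_eq_cvg; near=> r.
have rs : 0 < r - (t - s).
  by rewrite subr_gt0; near: r; apply: lt_nbhsr; lra.
rewrite /= /f (max_l (ltW rs)) -(C0_add SS) ?subr_ge0 ?(ltW rs) ?(ltW st)//.
  by rewrite subrK.
by rewrite -subr_ge0 ltW.
Unshelve. all: by end_near. Qed.

(** * The integrated inequality *)

(** The evolution variational inequality integrated over [(0, t)]. Unlike the
    differential form it compares [S t u] with [u] and nothing in between, so that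
    it passes to the limit along convergent sequences of data when [F] is lower
    semicontinuous. *)
Record integral_flow (R : realType) (Y : metricType R) (F : Y -> \bar R)
    (lambda : R) (S : R -> Y -> Y) : Prop := {
  integral_semigroup : C0_semigroup S ;
  integral_domain : forall (t : R) u, 0 < t -> domain F (S t u) ;
  integral_evi : forall (t : R) u v, 0 < t -> domain F v ->
    expR (lambda * t) * mdist (S t u) v ^+ 2 - mdist u v ^+ 2 <=
    2 * exp_integral lambda t * (fine (F v) - fine (F (S t u))) }.

Lemma domain_fineK (R : realType) (Y : Type) (F : Y -> \bar R) (w : Y) :
  (forall w, F w <> -oo%E) -> domain F w -> (fine (F w))%:E = F w.
Proof.
move=> Fny; rewrite /domain/=; move: (Fny w).
by case: (F w).
Qed.

(** On [(0, T]] the monotonicity of [F] along the flow allows [F (S r u)] to be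
    replaced with the constant [F (S T u)]. The differential inequality then says
    that [g t = expR (lambda * t) * d^2 (S t u, v) - K * exp_integral lambda t]
    has nonpositive upper right derivative, so that [g] decreases. The start of
    the interval is sent to 0 only at the end: the monotonicity of [F] is known
    for positive times only. *)
Lemma integral_flow_of_lambda_flow (R : realType) (Y : metricType R)
    (F : Y -> \bar R) (lambda : R) (S : R -> Y -> Y) :
  (forall w, F w <> -oo%E) -> lambda_flow F lambda S ->
  integral_flow F lambda S.
Proof.
move=> Fny fS; split; [exact: flow_semigroup fS|exact: flow_domain fS|].
move=> T u v T0 Dv; have SS := flow_semigroup fS.
pose zeta r := mdist (S r u) v ^+ 2.
pose K := 2 * (fine (F v) - fine (F (S T u))).
pose g t := expR (lambda * t) * zeta t - K * exp_integral lambda t.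
have cvg_g (G : set_system R) (FG : Filter G) t : G --> t ->
    S r u @[r --> G] --> S t u -> g r @[r --> G] --> g t.
  move=> Gt GS; apply: cvgB; apply: cvgM.
  - apply: continuous_cvg; first exact: continuous_expR.
    by apply: cvgM; [exact: cvg_cst|].
  - by rewrite /zeta expr2; apply: cvgM; apply: cvg_mdist => //; exact: cvg_cst.
  - exact: cvg_cst.
  - by apply: continuous_cvg; [exact: continuous_exp_integral|].
have mono s : 0 < s -> s <= T -> g T <= g s.
  move=> s0 sT; apply: le_of_right_increments => // [t e|t]; last first.
    move=> /andP[st _]; apply: cvg_g; first exact: cvg_id.
    by apply: orbit_continuous; rewrite // (lt_trans s0).
  move=> /andP[st tT] e0.
  have t0 : 0 < t by exact: lt_le_trans st.
  pose L := K - lambda * zeta t.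
  have zL : (upper_right_derivative zeta t <= L%:E)%E.
    have := flow_evi fS Dv (ltW t0) (flow_domain fS u t0).
    rewrite -/zeta.
    have := flow_nonincreasing fS u t0 (ltW tT).
    rewrite -(domain_fineK Fny Dv) -(domain_fineK Fny (flow_domain fS u t0)).
    rewrite -(domain_fineK Fny (flow_domain fS u T0)) lee_fin => FtT.
    case: (upper_right_derivative _ _) => [r| |].
    + by rewrite -EFinM -!EFinD !lee_fin /L /K /zeta; lra.
    + by rewrite gt0_muley ?lte_fin ?invr_gt0//.
    + by rewrite leNye.
  pose E := expR (lambda * t).
  have E0 : 0 < E by exact: expR_gt0.
  (* The bracket below tends to [e'], hence is eventually at most [2 * e'];
     multiplied by [E * h] this is [e * h]. *)
  pose e' := e / (2 * E).
  have e'0 : 0 < e' by rewrite divr_gt0// mulr_gt0.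
  have lim : expR (lambda * h) * (L + e') - L * (exp_integral lambda h / h)
      @[h --> 0^'+] --> e'.
    have {2}-> : e' = 1 * (L + e') - L * 1 by lra.
    apply: cvgB; apply: cvgM;
      [exact: cvg_expRM0|exact: cvg_cst|exact: cvg_cst|exact: cvg_exp_integral].
  near=> h.
  have h0 : 0 < h by near: h; exact: nbhs_right_gt.
  have zh : zeta (t + h) <= zeta t + (L + e') * h.
    by near: h; exact: near_upper_right_derivative.
  have lh : expR (lambda * h) * (L + e') - L * (exp_integral lambda h / h)
      < 2 * e' by near: h; apply: (cvgr_lt _ lim); lra.
  have {}lh : expR (lambda * h) * (L + e') * h - L * exp_integral lambda h
      <= 2 * e' * h.
    have := ler_wpM2r (ltW h0) (ltW lh); rewrite mulrBl -[L * _ * h]mulrA.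
    by rewrite divfK// gt_eqF.
  have -> : g (t + h) = g t + E * (expR (lambda * h) * (zeta (t + h) - zeta t)
      - L * exp_integral lambda h).
    rewrite /g exp_integralD mulrDr expRD -/E /L.
    have -> : expR (lambda * h) = lambda * exp_integral lambda h + 1.
      by rewrite mul_exp_integral subrK.
    by ring.
  rewrite lerD2l; apply: (@le_trans _ _ (E * (2 * e' * h))); last first.
    by rewrite /e' le_eqVlt; apply/orP; left; apply/eqP; field; rewrite gt_eqF.
  rewrite ler_wpM2l ?(ltW E0)// (le_trans _ lh)// lerD2r -mulrA.
  by rewrite ler_wpM2l ?expR_ge0//; lra.
have g0 : g T <= g 0.
  have gcvg : g r @[r --> 0^'+] --> g 0.
    apply: cvg_g; first exact: cvg_within.
    by rewrite (C0_zero SS); exact: C0_right_limit.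
  apply: (cvgr_to_ge gcvg); near=> s; apply: mono.
    by near: s; exact: nbhs_right_gt.
  by near: s; exact: nbhs_right_ltW.
move: g0; rewrite /g mulr0 expR0 mul1r /zeta (C0_zero SS) /K.
have -> : exp_integral lambda 0 = 0.
  by rewrite /exp_integral mulr0 expR0 subrr mul0r if_same.
by lra.
Unshelve. all: by end_near. Qed.

(** Taking [v = u] in the integrated inequality. *)
Lemma integral_flow_nonincreasing (R : realType) (Y : metricType R)
    (F : Y -> \bar R) (lambda : R) (S : R -> Y -> Y) (t : R) (u : Y) :
  integral_flow F lambda S -> domain F u -> 0 <= t ->
  domain F (S t u) /\ fine (F (S t u)) <= fine (F u).
Proof.
move=> fS Du; rewrite le_eqVlt => /predU1P[<-|t0].
  by rewrite (C0_zero (integral_semigroup fS)).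
split; first exact (integral_domain fS u t0).
have := integral_evi fS u t0 Du; rewrite mdistxx expr0n subr0.
have E0 := exp_integral_gt0 lambda t0.
have : 0 <= expR (lambda * t) * mdist (S t u) u ^+ 2.
  by rewrite mulr_ge0 ?expR_ge0// sqr_ge0.
move=> /le_trans /[apply]; rewrite pmulr_rge0 ?subr_ge0// mulr_gt0//.
Qed.

(** * Contraction *)

(** Over a step [h], the inequality for [S t u] tested against [S t v] and
    [expR (lambda * h)] times the one for [S t v] tested against [S (t + h) u]
    add up to
    [expR (2 * lambda * h) * delta (t + h) - delta t <=
    2 * exp_integral lambda h * (b t - b (t + h) + O(h))], where [delta] is the
    squared distance between the orbits and [b] is [F] along the orbit of [v].
    The right-hand side is a step times the increment of a function of time, so
    that [le_of_small_increments] applies. *)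
Lemma integral_flow_contraction (R : realType) (Y : metricType R)
    (F : Y -> \bar R) (lambda : R) (S : R -> Y -> Y) (T : R) (u v : Y) :
  (forall w, F w <> -oo%E) -> bounded_from_below F ->
  integral_flow F lambda S -> domain F u -> domain F v -> 0 <= T ->
  mdist (S T u) (S T v) <= expR (- (lambda * T)) * mdist u v.
Proof.
move=> Fny [m mF] fS Du Dv T0; have SS := integral_semigroup fS.
have fF w : domain F w -> m <= fine (F w).
  by move=> Dw; rewrite -lee_fin domain_fineK.
pose a t := fine (F (S t u)); pose b t := fine (F (S t v)).
pose delta t := mdist (S t u) (S t v) ^+ 2.
pose phi t := expR (lambda * t) ^+ 2 * delta t.
pose K := (fine (F u) - m) + (fine (F v) - m).
pose C := expR (`|lambda| * T).
have C0 : 0 < C by exact: expR_gt0.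
(* Two factors [C] bound [expR (lambda * t) ^+ 2], the third one comes from
   [exp_integral lambda h <= h * C]; [K] bounds the gap between the values of
   [F] along the two orbits. *)
pose H t := 2 * C ^+ 3 * (b t - `|lambda| * C * K * t).
have : phi T <= phi 0.
  apply: (@le_of_small_increments _ _ H) => // t h t0.
  rewrite le_eqVlt => /predU1P[<-|h0 thT].
    by rewrite addr0 mul0r addr0.
  have [Dut aut] := integral_flow_nonincreasing fS Du t0.
  have [Dvt bvt] := integral_flow_nonincreasing fS Dv t0.
  have [DU aU] := integral_flow_nonincreasing fS Dut (ltW h0).
  have [DV bV] := integral_flow_nonincreasing fS Dvt (ltW h0).
  have := integral_evi fS (S t u) h0 Dvt.
  have := integral_evi fS (S t v) h0 DU.
  rewrite /phi /H /delta /a /b.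
  rewrite !(C0_add SS _ t0 (ltW h0)).
  rewrite (metric_sym (S h (S t v))) (metric_sym (S t v) (S h _)).
  rewrite (mulrDr lambda t h) expRD.
  have mU := fF _ DU; have mV := fF _ DV.
  have Eexp : expR (lambda * h) = lambda * exp_integral lambda h + 1.
    by rewrite mul_exp_integral subrK.
  have hT : h <= T by lra.
  have tT : t <= T by lra.
  have EC : exp_integral lambda h <= h * C.
    have /andP[_ /le_trans] := exp_integral_bounds lambda (ltW h0); apply.
    by rewrite ler_wpM2l ?(ltW h0)// ler_expR ler_wpM2l.
  have lC : expR (lambda * t) <= C.
    rewrite ler_expR (le_trans (ler_norm _))// normrM (ger0_norm t0).
    by rewrite ler_wpM2l.
  have l0 : 0 < expR (lambda * t) by exact: expR_gt0.
  have E0 := exp_integral_gt0 lambda h0.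
  have eh0 : 0 < expR (lambda * h) by exact: expR_gt0.
  move: Eexp EC lC l0 E0 eh0; rewrite -/C.
  move: (expR (lambda * t)) (expR (lambda * h)) (exp_integral _ _) => l eh E.
  move=> Eexp EC lC l0 E0 eh0.
  move: (mdist (S h (S t u)) (S h (S t v)) ^+ 2) (mdist (S h (S t u)) (S t v) ^+ 2).
  move: (mdist (S t u) (S t v) ^+ 2) => D D' D1.
  move: mU mV aU bV aut bvt.
  move: (fine (F (S h (S t u)))) (fine (F (S h (S t v)))) => fU' fV'.
  move: (fine (F (S t u))) (fine (F (S t v))) => fU fV.
  move=> mU mV aU bV aut bvt i2 i1.
  have K0 : 0 <= K by rewrite /K; lra.
  have L0 : 0 <= `|lambda| by [].
  pose B := fV - fV' + `|lambda| * (h * C) * K.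
  have B0 : 0 <= B.
    by rewrite addr_ge0 ?subr_ge0// !mulr_ge0// ltW.
  have le1 : lambda * (fU' - fV') <= `|lambda| * K.
    rewrite (le_trans (ler_norm _))// normrM ler_wpM2l// ler_norml /K.
    by apply/andP; split; lra.
  have le2 : lambda * E * (fU' - fV') <= `|lambda| * (h * C) * K.
    rewrite mulrAC (le_trans (ler_wpM2r (ltW E0) le1))//.
    by rewrite mulrAC ler_wpM2r// ler_wpM2l.
  have le3 : eh ^+ 2 * D' - D <= 2 * E * B.
    have le4 : 2 * E * (fV - fV' + lambda * E * (fU' - fV')) <= 2 * E * B.
      by rewrite ler_wpM2l ?lerD2l// mulr_ge0// ltW.
    apply: le_trans le4.
    have := ler_wpM2l (ltW eh0) i2; rewrite Eexp in i1 *; lra.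
  have le4 : 2 * E * B <= 2 * (h * C) * B.
    by rewrite ler_wpM2r// ler_wpM2l.
  have hCB : 0 <= 2 * (h * C) * B by rewrite !mulr_ge0// ltW.
  have le5 : l ^+ 2 * (eh ^+ 2 * D' - D) <= C ^+ 2 * (2 * (h * C) * B).
    apply: (@le_trans _ _ (l ^+ 2 * (2 * (h * C) * B))).
      by rewrite ler_wpM2l ?sqr_ge0// (le_trans le3).
    by rewrite ler_wpM2r// ler_pXn2r// ?nnegrE ltW.
  by move: le5; rewrite /B; lra.
rewrite /phi /delta !(C0_zero SS) mulr0 expR0 expr1n mul1r -exprMn.
rewrite ler_pXn2r ?nnegrE ?mulr_ge0 ?expR_ge0 ?mdist_ge0// => le0.
by rewrite expRN mulrC ler_pdivlMr ?expR_gt0// mulrC.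
Qed.

(** * Differential inequality and convexity *)

(** Dividing the integrated inequality on [(t, t + h)] by [h] and letting [h]
    tend to 0; lower semicontinuity keeps [F (S (t + h) u)] above [c]. A level
    [c] in place of [F (S t u)] covers the case of an infinite value. *)
Lemma integral_flow_upper_right_derivative (R : realType) (Y : metricType R)
    (F : Y -> \bar R) (lambda : R) (S : R -> Y -> Y) (t c : R) (u v : Y) :
  (forall w, F w <> -oo%E) -> lower_semicontinuous F ->
  integral_flow F lambda S -> domain F v -> 0 <= t -> (c%:E < F (S t u))%E ->
  (upper_right_derivative (fun r => mdist (S r u) v ^+ 2)%R t <=
   (2 * (fine (F v) - c) - lambda * mdist (S t u) v ^+ 2)%:E)%E.
Proof.
move=> Fny lscF fS Dv t0 cF; have SS := integral_semigroup fS.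
set L := 2 * _ - _.
apply/lee_addgt0Pr => e e0; apply: upper_right_derivative_le.
have St : S h (S t u) @[h --> 0^'+] --> S t u by exact: C0_right_limit.
have [V nV VF] := lscF _ _ cF.
have lim : exp_integral lambda h / h *
    (2 * (fine (F v) - c) - lambda * mdist (S h (S t u)) v ^+ 2)
    @[h --> 0^'+] --> L.
  rewrite -[X in _ --> X]mul1r; apply: cvgM; first exact: cvg_exp_integral.
  apply: cvgB; first exact: cvg_cst.
  apply: cvgM; first exact: cvg_cst.
  by apply: cvgM; apply: cvg_mdist => //; exact: cvg_cst.
near=> h.
have h0 : 0 < h by near: h; exact: nbhs_right_gt.
have cFh : (c%:E < F (S h (S t u)))%E by apply: VF; near: h; exact: St.
have : exp_integral lambda h / h *
    (2 * (fine (F v) - c) - lambda * mdist (S h (S t u)) v ^+ 2) < L + e.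
  by near: h; apply: (cvgr_lt _ lim); rewrite ltrDl.
rewrite mulrAC ltr_pdivrMr// (C0_add SS _ t0 (ltW h0)) => /ltW; apply: le_trans.
have Dh : domain F (S h (S t u)) by exact (integral_domain fS (S t u) h0).
have {}cFh : c <= fine (F (S h (S t u))).
  by rewrite -lee_fin domain_fineK// ltW.
have := integral_evi fS (S t u) h0 Dv.
have -> : expR (lambda * h) = lambda * exp_integral lambda h + 1.
  by rewrite mul_exp_integral subrK.
have E0 := exp_integral_gt0 lambda h0.
have := ler_wpM2l (ltW E0) cFh.
by lra.
Unshelve. all: by end_near. Qed.

(** The differential inequality at [t] follows from the levels [c < F (S t u)]:
    [c] tends to [F (S t u)] if this value is finite, and to [+oo] if it is
    infinite. *)
Lemma lambda_flow_of_integral_flow (R : realType) (Y : metricType R)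
    (F : Y -> \bar R) (lambda : R) (S : R -> Y -> Y) :
  (forall w, F w <> -oo%E) -> lower_semicontinuous F ->
  integral_flow F lambda S -> lambda_flow F lambda S.
Proof.
move=> Fny lscF fS; have SS := integral_semigroup fS.
split.
- exact: SS.
- exact: integral_domain fS.
- move=> u s t s0 st.
  have Ds : domain F (S s u) by exact (integral_domain fS u s0).
  have ts : 0 <= t - s by rewrite subr_ge0.
  have [D le] := integral_flow_nonincreasing fS Ds ts.
  have <- : s + (t - s) = t by lra.
  rewrite (C0_add SS _ (ltW s0) ts).
  by rewrite -(domain_fineK Fny D) -(domain_fineK Fny Ds) lee_fin.
- move=> u v t Dv t0 Dt.
  have key e : 0 < e -> (upper_right_derivative
      (fun r => mdist (S r u) v ^+ 2)%R t <= (2 * (fine (F v) - (fine (F (S t u))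
        - e)) - lambda * mdist (S t u) v ^+ 2)%:E)%E.
    move=> e0; apply: integral_flow_upper_right_derivative => //.
    by rewrite -[ltRHS](domain_fineK Fny Dt) lte_fin ltrBlDr ltrDl.
  rewrite -(domain_fineK Fny Dt) -(domain_fineK Fny Dv).
  move: (upper_right_derivative _ _) key => [r| |] key.
  + rewrite -EFinM -!EFinD lee_fin; apply/ler_addgt0Pr => e /key.
    by rewrite lee_fin; lra.
  + by have := key _ ltr01; rewrite leye_eq.
  + by rewrite gt0_muleNy ?lte_fin ?invr_gt0// !addNye leNye.
- move=> u v Dv Fu.
  have key c : (upper_right_derivative (fun r => mdist (S r u) v ^+ 2)%R 0 <=
      (2 * (fine (F v) - c) - lambda * mdist (S 0 u) v ^+ 2)%:E)%E.
    apply: integral_flow_upper_right_derivative => //.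
    by rewrite (C0_zero SS) Fu ltry.
  move: (upper_right_derivative _ _) key => [r| |] key //.
  + exfalso; have := key (fine (F v) - (lambda * mdist (S 0 u) v ^+ 2 + r) / 2 + 1).
    by rewrite lee_fin; lra.
  + by have := key 0; rewrite leye_eq.
Qed.

(** The flow started at [g s] is tested against both endpoints, and the two
    inequalities are averaged with weights [1 - s] and [s]. Whatever the position
    of a point, the averaged squares of its distances to the endpoints are at
    least [s * (1 - s) * d^2 (g 0, g 1)], with equality at [g s]; hence
    [F (S h (g s))] is below the convexity bound for every [h > 0], and
    lower semicontinuity lets [h] tend to 0. *)
Lemma geodesically_convex_of_integral_flow (R : realType) (X : metricType R)
    (F : X -> \bar R) (lambda : R) (S : R -> X -> X) :
  (forall w, F w <> -oo%E) -> lower_semicontinuous F ->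
  integral_flow F lambda S -> geodesically_convex F lambda.
Proof.
move=> Fny lscF fS g geo s /andP[].
rewrite le_eqVlt => /predU1P[<- _|s0].
  by rewrite subr0 mul1e mul0e adde0 mulr0 !mul0r sube0.
rewrite le_eqVlt => /predU1P[->|s1].
  by rewrite subrr mul0e mul1e add0e mulr0 !mul0r sube0.
have s1' : 0 < 1 - s by rewrite subr_gt0.
have Fbig (x y : \bar R) (z : R) : x <> -oo%E -> y <> -oo%E ->
    ~ (x < +oo /\ y < +oo)%E ->
    ((1 - s)%:E * x + s%:E * y - z%:E = +oo)%E.
  case: x => [x| |] //; case: y => [y| |] // _ _.
  - by move=> []; rewrite !ltry.
  - by move=> _; rewrite gt0_muley ?lte_fin.
  - by move=> _; rewrite gt0_muley ?lte_fin.
  - by move=> _; rewrite !gt0_muley ?lte_fin.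
have [[D0 D1]|nD] := pselect (domain F (g 0) /\ domain F (g 1)); last first.
  by rewrite Fbig ?leey//; exact: Fny.
rewrite -(domain_fineK Fny D0) -(domain_fineK Fny D1) -!EFinM -EFinD.
rewrite leNgt; apply/negP => /lscF[V nV VF].
have SV : \forall h \near 0^'+, V (S h (g s)).
  exact: (C0_right_limit (integral_semigroup fS)).
near (0 : R)^'+ => h.
have h0 : 0 < h by near: h; exact: nbhs_right_gt.
have : V (S h (g s)) by near: h.
move=> /VF.
have Dh : domain F (S h (g s)) by exact (integral_domain fS (g s) h0).
rewrite -(domain_fineK Fny Dh) lte_fin ltNge => /negP; apply.
have s01 : 0 <= s <= 1 by rewrite !ltW.
have i0 := integral_evi fS (g s) h0 D0.
have i1 := integral_evi fS (g s) h0 D1.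
move: i0 i1; rewrite (geo s 0) ?lexx ?ler01// (geo s 1) ?lexx ?ler01//.
rewrite subr0 (ger0_norm (ltW s0)) distrC (ger0_norm (ltW s1')).
have tri := metric_triangle (g 0) (S h (g s)) (g 1).
rewrite (metric_sym (g 0) (S h _)) in tri.
have E0 := exp_integral_gt0 lambda h0.
have eh0 := expR_gt0 (lambda * h).
have Eexp : expR (lambda * h) = lambda * exp_integral lambda h + 1.
  by rewrite mul_exp_integral subrK.
have d0 := mdist_ge0 (g 0) (g 1).
move: tri E0 eh0 Eexp d0.
move: (mdist _ (g 0)) (mdist _ (g 1)) (mdist _ _) => a b d.
move: (expR _) (exp_integral _ _) => eh E tri E0 eh0 Eexp d0 i0 i1.
(* The gap between [(1 - s) a^2 + s b^2] and [s (1 - s) (a + b)^2] is the square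
   of [(1 - s) a - s b]. *)
have ab : s * (1 - s) * d ^+ 2 <= (1 - s) * a ^+ 2 + s * b ^+ 2.
  apply: (@le_trans _ _ (s * (1 - s) * (a + b) ^+ 2)).
    by rewrite ler_wpM2l ?mulr_ge0 ?(ltW s0) ?(ltW s1')// ler_pXn2r// nnegrE// (le_trans d0).
  have : 0 <= ((1 - s) * a - s * b) ^+ 2 by exact: sqr_ge0.
  by lra.
have j := lerD (ler_wpM2l (ltW s1') i0) (ler_wpM2l (ltW s0) i1).
have k := ler_wpM2l (ltW eh0) ab.
rewrite -(ler_pM2l E0).
rewrite Eexp in j k.
by lra.
Unshelve. all: by end_near. Qed.

(** * Extension from a dense subset *)

(** The value [y] is described by its distances to the values of [f], rather
    than as the limit along a chosen sequence: this makes every later identity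
    between extended maps a consequence of the triangle inequality. *)
Lemma lipschitz_extension (R : realType) (X Z : metricType R) (X0 : set X)
    (f : X0 -> Z) (M : R) :
  complete_metric Z -> 0 <= M ->
  (forall (u : X) (e : R), 0 < e -> exists w : X0, mdist (val w) u < e) ->
  (forall w z : X0, mdist (f w) (f z) <= M * mdist w z) ->
  forall u : X, exists y : Z,
    forall w : X0, mdist (f w) y <= M * mdist (val w) u.
Proof.
move=> cZ M0 X0d lipf u.
have /choice[w wP] : forall n : nat, exists w : X0,
    mdist (val w) u < n.+1%:R^-1 by move=> n; apply: X0d.
have wu : mdist (val (w n)) u @[n --> \oo] --> (0 : R).
  apply: (squeeze_cvgr _ (cvg_cst 0) (@cvg_harmonic R)).
  by near=> n; rewrite mdist_ge0 ltW.
have Mwu : M * mdist (val (w n)) u @[n --> \oo] --> (0 : R).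
  by rewrite -(mulr0 M); apply: cvgM => //; exact: cvg_cst.
have [|y fy] := cZ (fun n => f (w n)).
  apply/cauchy_exP => e e0.
  have e20 : 0 < e / 2 by rewrite divr_gt0.
  have [N _ NP] := cvgr_lt _ Mwu _ e20.
  exists (f (w N)); exists N => // n /= Nn.
  rewrite ballEmdist/=; apply: le_lt_trans (lipf _ _) _.
  apply: (@le_lt_trans _ _ (M * mdist (val (w N)) u + M * mdist (val (w n)) u)).
    rewrite -mulrDr ler_wpM2l// (metric_sym (val (w n))).
    exact: (metric_triangle (val (w N)) u (val (w n))).
  by rewrite [ltRHS]splitr ltrD// NP/=.
exists y => z.
have lim : mdist (f z) (f (w n)) - M * mdist (val (w n)) u @[n --> \oo]
    --> mdist (f z) y.
  rewrite -[X in _ --> X]subr0; apply: cvgB => //.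
  by apply: cvg_mdist => //; exact: cvg_cst.
apply: (cvgr_to_le lim); near=> n.
rewrite lerBlDr -mulrDr (le_trans (lipf _ _))// ler_wpM2l//.
rewrite (metric_sym (val (w n))).
exact: (metric_triangle (val z) u (val (w n))).
Unshelve. all: by end_near. Qed.

(** Each [S t] extends by contraction, and the semigroup laws follow by density.
    For the inequality at arbitrary [u] and [v], both points are approximated by
    points of [X0]: the distances converge, [F] converges along the recovery
    sequence of [v], and [F] along the approximations of [S t u] stays above any
    level below its value at the limit. *)
Lemma integral_flow_extension (R : realType) (X : metricType R)
    (F : X -> \bar R) (lambda : R) (X0 : set X) (S : R -> X0 -> X0) :
  complete_metric X -> (forall w, F w <> -oo%E) -> lower_semicontinuous F ->
  bounded_from_below F -> X0 `<=` domain F ->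
  (forall u : X, exists u_ : nat -> X,
      [/\ forall n, X0 (u_ n),
          mdist (u_ n) u @[n --> \oo] --> (0 : R)
        & F (u_ n) @[n --> \oo] --> F u]) ->
  integral_flow (F \o (val : X0 -> X)) lambda S ->
  exists Sbar : R -> X -> X, integral_flow F lambda Sbar /\ extends_flow S Sbar.
Proof.
move=> cX Fny lscF bF X0F recov fS; have SS := integral_semigroup fS.
have DX0 (w : X0) : domain F (val w) by apply: X0F; exact: set_valP.
have rec u : exists w : nat -> X0, (val (w n) @[n --> \oo] --> u) /\
    (F (val (w n)) @[n --> \oo] --> F u).
  have [u_ [X0u du Fu]] := recov u.
  have /choice[w wu] : forall n, exists w : X0, val w = u_ n.
    by move=> n; exists (SigSub (mem_set (X0u n))).
  exists w; split; last by under eq_fun do rewrite wu.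
  apply/metricType_numDomainType.cvgrPdist_lt => e e0.
  near=> n; rewrite wu metric_sym; near: n; exact: (cvgr_lt _ du).
have X0d (u : X) (e : R) : 0 < e -> exists w : X0, mdist (val w) u < e.
  move=> e0; have [w [wu _]] := rec u.
  have [N _ /(_ N (leqnn N)) NP] :=
    metricType_numDomainType.cvgr_dist_lt wu e0.
  by exists (w N); rewrite metric_sym.
pose M t := expR (- (lambda * t)).
have M0 t : 0 < M t by exact: expR_gt0.
have MD t h : M h * M t = M (t + h).
  by rewrite /M -expRD mulrDr opprD addrC.
have /choice[Sp SpP] : forall p : R * X, exists y : X, 0 <= p.1 ->
    forall w : X0, mdist (val (S p.1 w)) y <= M p.1 * mdist (val w) p.2.
  move=> [t u] /=; have [t0|_] := leP 0 t; last by exists u.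
  have [|y yP] := @lipschitz_extension _ _ _ _ (fun w => val (S t w)) (M t)
    cX (ltW (M0 t)) X0d _ u; last by exists y.
  move=> w z; apply: (integral_flow_contraction _ _ fS (DX0 w) (DX0 z) t0).
    by move=> x; exact: Fny.
  by case: bF => m mF; exists m => x; exact: mF.
pose Sbar t u := Sp (t, u).
have SbarP t u w : 0 <= t ->
    mdist (val (S t w)) (Sbar t u) <= M t * mdist (val w) u.
  by move=> t0; exact: SpP (t, u) t0 w.
have ext : extends_flow S Sbar.
  move=> t u t0; apply/esym/mdist_positivity/eqP.
  by rewrite eq_le mdist_ge0 andbT (le_trans (SbarP _ _ _ t0))// mdistxx mulr0.
have eq_small (C : R) (x y u : X) : 0 <= C ->
    (forall w : X0, mdist x y <= C * mdist (val w) u) -> x = y.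
  move=> C0 xyC; apply/mdist_positivity/eqP.
  rewrite eq_le mdist_ge0 andbT; apply/ler_addgt0Pr => e e0; rewrite add0r.
  have [w wu] := X0d u (e / (C + 1)) (divr_gt0 e0 (ltr_wpDl C0 ltr01)).
  rewrite (le_trans (xyC w))// (le_trans (ler_wpM2l C0 (ltW wu)))//.
  rewrite mulrCA ler_piMr ?(ltW e0)// ler_pdivrMr ?ltr_wpDl//.
  by rewrite mul1r lerDl.
have lipS t u u' : 0 <= t -> mdist (Sbar t u) (Sbar t u') <= M t * mdist u u'.
  move=> t0; apply/ler_addgt0Pr => e e0.
  have e20 : 0 < e / (2 * M t) by rewrite divr_gt0// mulr_gt0.
  have [w wu] := X0d u _ e20.
  have := SbarP t u w t0; have := SbarP t u' w t0.
  have := metric_triangle (Sbar t u) (val (S t w)) (Sbar t u').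
  rewrite (metric_sym (Sbar t u) (val _)).
  have := ler_wpM2l (ltW (M0 t)) (metric_triangle (val w) u u').
  have := ler_wpM2l (ltW (M0 t)) (ltW wu).
  have -> : M t * (e / (2 * M t)) = e / 2 by field; rewrite gt_eqF.
  by rewrite mulrDr; lra.
have SbarS : C0_semigroup Sbar.
  split.
  - move=> t t0 u; apply/metricType_numDomainType.cvgrPdist_lt => e e0.
    near=> x; rewrite (le_lt_trans (lipS _ _ _ t0))// mulrC -ltr_pdivlMr//.
    near: x; apply: (metricType_numDomainType.cvgr_dist_lt (y := u)).
      exact: cvg_id.
    by rewrite divr_gt0.
  - move=> t h u t0 h0.
    apply: (eq_small (2 * M (t + h)) _ _ u); first by rewrite mulr_ge0// ltW.
    move=> w; have := SbarP (t + h) u w (addr_ge0 t0 h0).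
    have := SbarP h (Sbar t u) (S t w) h0; rewrite (C0_add SS _ t0 h0).
    have := ler_wpM2l (ltW (M0 h)) (SbarP t u w t0); rewrite mulrA MD.
    have := metric_triangle (Sbar (t + h) u) (val (S h (S t w)))
      (Sbar h (Sbar t u)).
    rewrite (metric_sym (Sbar (t + h) u) (val _)).
    by lra.
  - move=> u; apply: (eq_small 2 _ _ u) => // w.
    have := SbarP 0 u w (lexx _); rewrite (C0_zero SS).
    rewrite /M mulr0 oppr0 expR0 mul1r.
    have := metric_triangle (Sbar 0 u) (val w) u.
    by rewrite (metric_sym (Sbar 0 u) (val w)); lra.
  - move=> u; apply/metricType_numDomainType.cvgrPdist_lt => e e0.
    have e40 : 0 < e / 4 by rewrite divr_gt0.
    have [w wu] := X0d u _ e40.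
    have Mlim : M t * (e / 4) @[t --> 0^'+] --> e / 4.
      rewrite -[X in _ --> X]mul1r; apply: cvgM; last exact: cvg_cst.
      have -> : M = fun s => expR (- lambda * s).
        by apply/funext => s; rewrite /M mulNr.
      exact: cvg_expRM0.
    near=> t.
    have t0 : 0 <= t by apply: ltW; near: t; exact: nbhs_right_gt.
    have Mt : M t * (e / 4) < e / 2.
      by near: t; apply: (cvgr_lt _ Mlim); lra.
    have Sw : mdist (val w) (val (S t w)) < e / 4.
      near: t; apply: (metricType_numDomainType.cvgr_dist_lt
        (@C0_right_limit _ _ _ SS w)).
      by rewrite divr_gt0.
    have := SbarP t u w t0; have := ler_wpM2l (ltW (M0 t)) (ltW wu).
    have := metric_triangle u (val w) (Sbar t u).
    have := metric_triangle (val w) (val (S t w)) (Sbar t u).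
    by rewrite (metric_sym u (val w)); lra.
have key t u v (c : R) : 0 < t -> domain F v -> (c%:E < F (Sbar t u))%E ->
    expR (lambda * t) * mdist (Sbar t u) v ^+ 2 - mdist u v ^+ 2 <=
    2 * exp_integral lambda t * (fine (F v) - c).
  move=> t0 Dv cF.
  have [w [wu _]] := rec u; have [z [zv Fz]] := rec v.
  have Sw : val (S t (w n)) @[n --> \oo] --> Sbar t u.
    have : Sbar t (val (w n)) @[n --> \oo] --> Sbar t u.
      exact: (cvg_comp _ _ wu (@C0_continuous _ _ _ SbarS t (ltW t0) u)).
    apply: cvg_trans; apply: near_eq_cvg; near=> n.
    by rewrite ext// ltW.
  have [V nV VF] := lscF _ _ cF.
  have Fz' : fine (F (val (z n))) @[n --> \oo] --> fine (F v).
    by apply: fine_cvg; rewrite (domain_fineK Fny Dv).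
  have cvg_sqr (a b : nat -> X) (x y : X) : a n @[n --> \oo] --> x ->
      b n @[n --> \oo] --> y ->
      mdist (a n) (b n) ^+ 2 @[n --> \oo] --> mdist x y ^+ 2.
    by move=> ax byy; rewrite expr2; apply: cvgM; exact: cvg_mdist.
  have lim1 : expR (lambda * t) * mdist (val (S t (w n))) (val (z n)) ^+ 2
      - mdist (val (w n)) (val (z n)) ^+ 2 @[n --> \oo] -->
      expR (lambda * t) * mdist (Sbar t u) v ^+ 2 - mdist u v ^+ 2.
    by apply: cvgB; [apply: cvgM; [exact: cvg_cst|]|]; exact: cvg_sqr.
  have lim2 : 2 * exp_integral lambda t * (fine (F (val (z n))) - c)
      @[n --> \oo] --> 2 * exp_integral lambda t * (fine (F v) - c).
    by apply: cvgM; [exact: cvg_cst|apply: cvgB => //; exact: cvg_cst].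
  apply: (ler_cvg_to lim1 lim2); near=> n.
  apply: le_trans (integral_evi fS (w n) t0 (DX0 (z n) : domain (F \o val) _)) _.
  rewrite ler_wpM2l ?mulr_ge0 ?(ltW (exp_integral_gt0 _ t0))// lerD2l lerN2.
  have DSw : domain F (val (S t (w n))).
    exact (integral_domain fS (w n) t0).
  rewrite -lee_fin/= (domain_fineK Fny DSw) ltW//; apply: VF.
  by near: n; exact: Sw.
have Dbar t u : 0 < t -> domain F (Sbar t u).
  move=> t0; have [w _] := X0d u 1 ltr01.
  rewrite /domain/= ltey; apply/eqP => SF.
  have E0 := exp_integral_gt0 lambda t0.
  (* If [F] were infinite at [Sbar t u], [key] would hold at every level [c]; this
     one makes the right-hand side smaller than the left-hand side [B]. *)
  pose B := expR (lambda * t) * mdist (Sbar t u) (val w) ^+ 2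
    - mdist u (val w) ^+ 2.
  have := key t u (val w) (fine (F (val w)) - B / (2 * exp_integral lambda t) + 1).
  rewrite SF ltry => /(_ t0 (DX0 w) isT); rewrite -/B.
  have -> : 2 * exp_integral lambda t * (fine (F (val w)) - (fine (F (val w)) -
      B / (2 * exp_integral lambda t) + 1)) = B - 2 * exp_integral lambda t.
    by field; rewrite gt_eqF.
  by lra.
exists Sbar; split => //; split => // t u v t0 Dv.
have E0 := exp_integral_gt0 lambda t0.
apply/ler_addgt0Pr => e e0.
have := key t u v (fine (F (Sbar t u)) - e / (2 * exp_integral lambda t)) t0 Dv.
rewrite -[X in (_ < X)%E](domain_fineK Fny (Dbar t u t0)) lte_fin.
rewrite ltrBlDr ltrDl divr_gt0 ?mulr_gt0// => /(_ isT) /le_trans; apply.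
rewrite le_eqVlt; apply/orP; left; apply/eqP; field.
by rewrite gt_eqF.
Unshelve. all: by end_near. Qed.

(** * The extended flow *)

Theorem theorem3p3 (R : realType) (X : metricType R) (F : X -> \bar R)
    (lambda : R) (X0 : set X) (S : R -> X0 -> X0)
    (X_complete : complete_metric X)
    (F_notNy : forall w, F w <> -oo%E)
    (F_lsc : lower_semicontinuous F)
    (F_bounded : bounded_from_below F)
    (F_dense : dense (domain F))
    (X0_domain : X0 `<=` domain F)
    (X0_dense : forall u : X, exists u_ : nat -> X,
      [/\ forall n, X0 (u_ n),
          mdist (u_ n) u @[n --> \oo] --> (0 : R)
        & F (u_ n) @[n --> \oo] --> F u])
    (S_flow : lambda_flow (F \o (val : X0 -> X)) lambda S) :
  (exists Sbar : R -> X -> X,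
     [/\ lambda_flow F lambda Sbar,
         extends_flow S Sbar
       & forall S' : R -> X -> X, lambda_flow F lambda S' -> extends_flow S S' ->
           forall (t : R) (u : X), 0 <= t -> S' t u = Sbar t u])
  /\ geodesically_convex F lambda.
Proof.
have fS : integral_flow (F \o (val : X0 -> X)) lambda S.
  by apply: integral_flow_of_lambda_flow => // w; exact: F_notNy.
have [Sbar [fSbar ext]] := integral_flow_extension X_complete F_notNy F_lsc
  F_bounded X0_domain X0_dense fS.
split; last exact: geodesically_convex_of_integral_flow fSbar.
exists Sbar; split => //; first exact: lambda_flow_of_integral_flow.
move=> S' fS' ext' t u t0.
have [u_ [X0u du _]] := X0_dense u.
have cu : u_ n @[n --> \oo] --> u.
  apply/metricType_numDomainType.cvgrPdist_lt => e e0.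
  by near=> n; rewrite metric_sym; near: n; exact: (cvgr_lt _ du).
have c1 := cvg_comp _ _ cu (@C0_continuous _ _ _ (flow_semigroup fS') t t0 u).
have c2 := cvg_comp _ _ cu (@C0_continuous _ _ _ (integral_semigroup fSbar) t t0 u).
apply: (cvg_unique (@metric_hausdorff _ X) c1).
suff -> : S' t \o u_ = Sbar t \o u_ by exact: c2.
apply/funext => n /=.
pose w : X0 := SigSub (mem_set (X0u n)).
by rewrite -[u_ n]/(val w) ext' // ext.
Unshelve. all: by end_near. Qed.
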